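(* Let $X$ be a real Banach space with the Daugavet property and let $Y\subset X$ be a rich closed subspace. Then $Y$ has the Daugavet property. Moreover, $(Y,X)$ is a Daugavet pair.
   Context: All Banach spaces are real; $S(X)$ is the unit sphere of $X$. An operator on $X$ is a bounded linear operator from $X$ into some Banach space. $X$ has the Daugavet property if $\|\mathrm{Id}+R\|=1+\|R\|$ for every rank-one operator $R\colon X\to X$. For a closed subspace $Y\subset X$ with canonical embedding $J\colon Y\to X$, $(Y,X)$ is a Daugavet pair if $\|J+R\|=1+\|R\|$ for every rank-one operator $R\colon Y\to X$. For operators $T_1\colon X\to Y_1$, $T_2\colon X\to Y_2$ define $T_1\mathbin{\tilde+}T_2\colon X\to Y_1\oplus_1Y_2$, $x\mapsto(T_1x,T_2x)$, so $\|(T_1\mathbin{\tilde+}T_2)x\|=\|T_1x\|+\|T_2x\|$. $T$ is a strong Daugavet operator if for all $x,y\in S(X)$ and $\varepsilon>0$ there is $z\in S(X)$ with $\|T(z-y)\|<\varepsilon$ and $\|z+x\|>2-\varepsilon$. $T$ is narrow if $T\mathbin{\tilde+}x^*$ is a strong Daugavet operator for every $x^*\in X^*$. A closed subspace $Y\subset X$ is rich if the quotient map $q\colon X\to X/Y$ is narrow. *)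

(* Defs.v *)
From HB Require Import structures.
From mathcomp Require Import all_boot all_order all_algebra generic_quotient.
From mathcomp Require Import ring_quotient.
From mathcomp Require Import all_classical all_reals all_analysis.
From mathcomp Require Import lra.

Set Implicit Arguments.
Unset Strict Implicit.
Unset Printing Implicit Defensive.

Import Order.TTheory GRing.Theory Num.Theory.
Import numFieldNormedType.Exports.

Local Open Scope classical_set_scope.
Local Open Scope ring_scope.

HB.mixin Record isBoundedFun (R : realType) (V W : normedModType R)
    (f : V -> W) := {
  bounded_fun_subproof : bounded_fun_norm f
}.

#[short(type="boundedOp")]
HB.structure Definition BoundedOp (R : realType) (V W : normedModType R) :=
  {f of @GRing.Linear R V W *:%R f & @isBoundedFun R V W f}.

Notation "{ 'bounded' V '->' W }" := (boundedOp V%type W%type)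
  (at level 0, V at level 98, W at level 99, format "{ 'bounded'  V  ->  W }")
  : type_scope.

Record closedSubspace (R : realType) (X : normedModType R) := ClosedSubspace {
  closedSubspace_pred :> {pred X};
  closedSubspace_submod : submod_closed closedSubspace_pred;
  closedSubspace_closed : closed [set x | x \in closedSubspace_pred]
}.

HB.instance Definition _ (R : realType) (X : normedModType R)
    (Y : closedSubspace X) :=
  GRing.isSubmodClosed.Build R X (closedSubspace_pred Y)
    (closedSubspace_submod Y).

Lemma nonexpansive_cauchy (R : realType) (V W : normedModType R) (f : V -> W)
    (F : set_system V) : ProperFilter F ->
  (forall x y, `|f x - f y| <= `|x - y|) -> cauchy F -> cauchy (f @ F).
Proof.
move=> FF f1 /cauchyP Fc.
apply: cauchy_exP => e /Fc[x Fx]; exists (f x).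
have : F (f @^-1` ball (f x) e); last by [].
apply: filterS Fx => y; rewrite /= -!ball_normE /ball_/=.
exact: le_lt_trans (f1 x y).
Qed.

Section l1_sum.
Context {R : realType}.

(* An alias is needed: the canonical norm on V * W is the maximum norm. *)
Definition l1sum (V W : Type) : Type := (V * W)%type.

Section normed.
Variables V W : normedModType R.

HB.instance Definition _ := GRing.Lmodule.copy (l1sum V W) (V * W)%type.

Definition l1norm (p : l1sum V W) : R := `|p.1| + `|p.2|.

Lemma l1normD p q : l1norm (p + q) <= l1norm p + l1norm q.
Proof. by rewrite /l1norm addrACA lerD// ler_normD. Qed.

Lemma l1normZ a p : l1norm (a *: p) = `|a| * l1norm p.
Proof. by rewrite /l1norm !normrZ mulrDr. Qed.

Lemma l1norm_eq0 p : l1norm p = 0 -> p = 0.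
Proof.
case: p => v w /eqP; rewrite /l1norm paddr_eq0// !normr_eq0.
by move=> /andP[/eqP /= -> /eqP /= ->].
Qed.

HB.instance Definition _ :=
  Lmodule_isNormed.Build R (l1sum V W) l1normD l1normZ l1norm_eq0.

Lemma l1sum_normE (p : l1sum V W) : `|p| = `|p.1| + `|p.2|.
Proof. by []. Qed.
End normed.

Lemma l1sum_complete (V W : completeNormedModType R)
    (F : set_system (l1sum V W)) : ProperFilter F -> cauchy F -> cvg F.
Proof.
move=> FF Fc.
have le1 (p : l1sum V W) : `|p.1| <= `|p|.
  by rewrite l1sum_normE lerDl.
have le2 (p : l1sum V W) : `|p.2| <= `|p|.
  by rewrite l1sum_normE lerDr.
have c1 : cauchy ((fst : l1sum V W -> V) @ F).
  by apply: nonexpansive_cauchy Fc => x y; exact: (le1 (x - y)).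
have c2 : cauchy ((snd : l1sum V W -> W) @ F).
  by apply: nonexpansive_cauchy Fc => x y; exact: (le2 (x - y)).
move/cauchy_cvg: c1 => /cvg_ex[/= l1 /cvgrPdist_lt h1].
move/cauchy_cvg: c2 => /cvg_ex[/= l2 /cvgrPdist_lt h2].
apply/cvg_ex; exists ((l1, l2) : l1sum V W); apply/cvgrPdist_lt => e e0.
near=> p; rewrite l1sum_normE (splitr e) ltrD//.
- by near: p; apply: h1; rewrite divr_gt0.
- by near: p; apply: h2; rewrite divr_gt0.
Unshelve. all: by end_near. Qed.

HB.instance Definition _ (V W : completeNormedModType R) :=
  Uniform_isComplete.Build (l1sum V W) (@l1sum_complete V W).
End l1_sum.

Section subspace.
Context {R : realType}.

Definition subspace_type (X : normedModType R) (Y : closedSubspace X) : Type :=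
  {x : X | x \in Y}.

Section normed.
Variables (X : normedModType R) (Y : closedSubspace X).
Local Notation T := (subspace_type Y).

HB.instance Definition _ := SubChoice.copy T {x : X | x \in Y}.
HB.instance Definition _ := [SubChoice_isSubLmodule of T by <:].

Let subnorm (y : T) : R := `|\val y|.

Let subnormD (x y : T) : subnorm (x + y) <= subnorm x + subnorm y.
Proof. by rewrite /subnorm raddfD ler_normD. Qed.

Let subnormZ (a : R) (y : T) : subnorm (a *: y) = `|a| * subnorm y.
Proof. by rewrite /subnorm linearZ normrZ. Qed.

Let subnorm_eq0 (y : T) : subnorm y = 0 -> y = 0.
Proof. by move/normr0_eq0 => y0; apply/val_inj; rewrite y0 raddf0. Qed.

HB.instance Definition _ :=
  Lmodule_isNormed.Build R T subnormD subnormZ subnorm_eq0.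

Lemma subspace_normE (y : T) : `|y| = `|\val y|.
Proof. by []. Qed.

Definition subspace_incl : T -> X := \val.

Let subspace_incl_linear : linear subspace_incl.
Proof. by move=> a x y; rewrite /subspace_incl linearP. Qed.

Let subspace_incl_bounded : bounded_fun_norm subspace_incl.
Proof. by move=> r; exists r. Qed.

HB.instance Definition _ :=
  GRing.isLinear.Build R T X *:%R subspace_incl subspace_incl_linear.
HB.instance Definition _ :=
  isBoundedFun.Build R T X subspace_incl subspace_incl_bounded.
End normed.

Lemma subspace_complete (X : completeNormedModType R) (Y : closedSubspace X)
    (F : set_system (subspace_type Y)) : ProperFilter F -> cauchy F -> cvg F.
Proof.
move=> FF Fc; have : cauchy (subspace_incl (Y := Y) @ F).
  by apply: nonexpansive_cauchy Fc => x y; rewrite -raddfB.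
move=> /cauchy_cvg/cvg_ex[/= l Fl].
have Yl : l \in Y.
  apply: (closed_cvg _ (@closedSubspace_closed _ _ Y) _ l Fl) => //.
  by apply: nearW => -[].
apply/cvg_ex; exists (exist _ l Yl : subspace_type Y).
apply/cvgrPdist_lt => e e0; move/cvgrPdist_lt: Fl => /(_ e e0).
by apply: filterS => y; rewrite subspace_normE raddfB.
Qed.

HB.instance Definition _ (X : completeNormedModType R) (Y : closedSubspace X) :=
  Uniform_isComplete.Build (subspace_type Y) (@subspace_complete X Y).
End subspace.
Arguments subspace_incl {R X} Y.

Section quotient.
Context {R : realType}.
Local Open Scope quotient_scope.

Definition quotient_space (X : normedModType R) (Y : closedSubspace X) : Type :=
  Quotient.quot Y.

Section normed.
Variables (X : normedModType R) (Y : closedSubspace X).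
Local Notation Q := (quotient_space Y).

HB.instance Definition _ := GRing.Zmodule.copy Q (Quotient.quot Y).

Definition quotient_map (x : X) : Q := \pi_(Quotient.quot Y) x.

Lemma quotient_map_eq x x' : quotient_map x = quotient_map x' <-> x - x' \in Y.
Proof.
rewrite /quotient_map; split=> [/eqP|h].
  by rewrite -(Quotient.idealrBE Y).
by apply/eqP; rewrite -(Quotient.idealrBE Y).
Qed.

Lemma quotient_map_surj q : exists x, quotient_map x = q.
Proof. by exists (repr (q : Quotient.quot Y)); rewrite /quotient_map reprK. Qed.

Let quotient_mapB : zmod_morphism quotient_map.
Proof. exact: (@pi_is_zmod_morphism _ _ _ (Quotient.quot Y)). Qed.

HB.instance Definition _ :=
  GRing.isZmodMorphism.Build X Q quotient_map quotient_mapB.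

Definition quotient_scale (a : R) (q : Q) : Q :=
  quotient_map (a *: repr (q : Quotient.quot Y)).

Lemma quotient_scaleE a x :
  quotient_scale a (quotient_map x) = quotient_map (a *: x).
Proof.
apply/quotient_map_eq; rewrite -scalerBr; apply: rpredZ.
by apply/quotient_map_eq; rewrite /quotient_map reprK.
Qed.

Let scaleA (a b : R) (q : Q) :
  quotient_scale a (quotient_scale b q) = quotient_scale (a * b) q.
Proof.
by have [x <-] := quotient_map_surj q; rewrite !quotient_scaleE scalerA.
Qed.

Let scale1 : left_id 1 quotient_scale.
Proof.
by move=> q; have [x <-] := quotient_map_surj q; rewrite quotient_scaleE scale1r.
Qed.

Let scaleDr : right_distributive quotient_scale +%R.
Proof.
move=> a p q; have [x <-] := quotient_map_surj p.
have [y <-] := quotient_map_surj q.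
by rewrite -raddfD !quotient_scaleE scalerDr raddfD.
Qed.

Let scaleDl (q : Q) : {morph quotient_scale^~ q : a b / a + b}.
Proof.
move=> a b; have [x <-] := quotient_map_surj q.
by rewrite !quotient_scaleE scalerDl raddfD.
Qed.

HB.instance Definition _ :=
  GRing.Zmodule_isLmodule.Build R Q scaleA scale1 scaleDr scaleDl.

Let quotient_map_scalable : scalable quotient_map.
Proof. by move=> a x; rewrite -quotient_scaleE. Qed.

HB.instance Definition _ :=
  GRing.isScalable.Build R X Q *:%R quotient_map quotient_map_scalable.

(* The infimum of the norms of the representatives of q, i.e. the distance
   from any representative of q to Y. *)
Definition quotient_norm (q : Q) : R :=
  inf [set `|x| | x in [set x | quotient_map x = q]].

Lemma quotient_norm_le x : quotient_norm (quotient_map x) <= `|x|.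
Proof. by apply: ge_inf; [exists 0 => _ [y _ <-] | exists x]. Qed.

Lemma quotient_norm_lt q e : quotient_norm q < e ->
  exists2 x, quotient_map x = q & `|x| < e.
Proof.
have [x xq] := quotient_map_surj q.
have q0 : [set `|x| | x in [set x | quotient_map x = q]] !=set0.
  by exists `|x|, x.
by move=> /(inf_lt q0)[_ [y yq <-] ye]; exists y.
Qed.

Let quotient_normD p q :
  quotient_norm (p + q) <= quotient_norm p + quotient_norm q.
Proof.
apply/ler_addgt0Pr => e e0.
have [x <- xe] : exists2 x, quotient_map x = p & `|x| < quotient_norm p + e / 2.
  by apply: quotient_norm_lt; rewrite ltrDl divr_gt0.
have [y <- ye] : exists2 y, quotient_map y = q & `|y| < quotient_norm q + e / 2.
  by apply: quotient_norm_lt; rewrite ltrDl divr_gt0.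
rewrite -raddfD (le_trans (quotient_norm_le _))// (le_trans (ler_normD _ _))//.
by rewrite (splitr e) addrACA ltW// ltrD.
Qed.

Let quotient_norm_ge0 q : 0 <= quotient_norm q.
Proof.
have [x xq] := quotient_map_surj q.
by apply: lb_le_inf; [exists `|x|, x | move=> _ [y _ <-]].
Qed.

Let quotient_normZ_le a q : quotient_norm (a *: q) <= `|a| * quotient_norm q.
Proof.
have [->|a0] := eqVneq a 0.
  by rewrite scale0r normr0 mul0r -(raddf0 quotient_map)
    (le_trans (quotient_norm_le _))// normr0.
rewrite -ler_pdivrMl ?normr_gt0//; apply/ler_addgt0Pr => e e0.
have [x <- xe] : exists2 x, quotient_map x = q & `|x| < quotient_norm q + e.
  by apply: quotient_norm_lt; rewrite ltrDl.
rewrite ler_pdivrMl ?normr_gt0// -linearZ (le_trans (quotient_norm_le _))//.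
by rewrite normrZ ler_wpM2l// ltW.
Qed.

Let quotient_normZ a q : quotient_norm (a *: q) = `|a| * quotient_norm q.
Proof.
apply/eqP; rewrite eq_le quotient_normZ_le/=.
have [->|a0] := eqVneq a 0; first by rewrite normr0 mul0r.
rewrite -ler_pdivlMl ?normr_gt0// -normfV.
by rewrite -{1}[q](scalerK a0) quotient_normZ_le.
Qed.

Let quotient_norm_eq0 q : quotient_norm q = 0 -> q = 0.
Proof.
have [x <-] := quotient_map_surj q => x0.
rewrite -(raddf0 quotient_map); apply/quotient_map_eq; rewrite subr0.
have cY : closed [set x | x \in Y] by exact: closedSubspace_closed.
suff : closure [set x | x \in Y] x by move/cY.
move=> A /nbhs_normP[e /= e0 eA].
have [y yx ye] : exists2 y, quotient_map y = quotient_map x & `|y| < e.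
  by apply: quotient_norm_lt; rewrite x0.
exists (x - y); split; first exact/quotient_map_eq.
by apply: eA; rewrite /= opprB addrCA subrr addr0.
Qed.

HB.instance Definition _ :=
  Lmodule_isNormed.Build R Q quotient_normD quotient_normZ quotient_norm_eq0.

Let quotient_map_bounded : bounded_fun_norm quotient_map.
Proof. by move=> r; exists r => x; exact/le_trans/quotient_norm_le. Qed.

HB.instance Definition _ :=
  isBoundedFun.Build R X Q quotient_map quotient_map_bounded.

Lemma quotient_normE (q : Q) : `|q| = quotient_norm q.
Proof. by []. Qed.
End normed.

Lemma quotient_complete (X : completeNormedModType R) (Y : closedSubspace X)
    (F : set_system (quotient_space Y)) : ProperFilter F -> cauchy F -> cvg F.
Proof.
move=> FF /cauchyP Fc; pose r n : R := 2^-1 ^+ n.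
have r0 n : 0 < r n by rewrite exprn_gt0.
have rS n : r n = r n.+1 + r n.+1.
  by rewrite /r exprS; lra.
have r_lt e : 0 < e -> exists n, r n < e.
  move=> e0; have : r @ \oo --> (0 : R).
    by apply: cvg_expr; rewrite gtr0_norm// invf_lt1// ltr1n.
  move=> /cvgr0_norm_lt/(_ _ e0)[n _ /(_ n (leqnn n)) rn]; exists n.
  exact: le_lt_trans (ler_norm _) rn.
have /choice[q Fq] n : exists p, F (ball p (r n)) by exact: Fc.
have qS n : `|q n.+1 - q n| < r n + r n.
  have [p [/= pn pSn]] := @filter_ex _ _ FF _ (filterI (Fq n) (Fq n.+1)).
  move: pn pSn; rewrite -!ball_normE /ball_/= => pn pSn.
  rewrite -(subrKA p) (le_lt_trans (ler_normD _ _))// addrC ltrD//.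
    by rewrite distrC.
  by rewrite (lt_trans pSn)// [ltRHS]rS ltrDl.
have /choice[f fP] (nx : nat * X) : exists y,
    quotient_map Y nx.2 = q nx.1 ->
    quotient_map Y y = q nx.1.+1 /\ `|y - nx.2| < r nx.1 + r nx.1.
  case: nx => n x /=.
  have [xq|] := pselect (quotient_map Y x = q n); last by exists 0.
  have [y yq yr] := quotient_norm_lt (qS n).
  by exists (y + x); rewrite raddfD/= yq xq subrK addrK.
have [x0 x0q] := quotient_map_surj (q 0%N).
pose u := nat_rect (fun=> X) x0 (fun n x => f (n, x)).
have uq n : quotient_map Y (u n) = q n.
  by elim: n => //= n /(fP (n, _))[].
have uS n : `|u n.+1 - u n| < r n + r n by have [] := fP (n, u n) (uq n).
have ur n k : `|u (n + k)%N - u n| <= 4 * r n - 4 * r (n + k)%N.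
  elim: k => [|k IH]; first by rewrite addn0 !subrr normr0.
  rewrite addnS -(subrKA (u (n + k)%N)) (le_trans (ler_normD _ _))//.
  move: (uS (n + k)%N) (rS (n + k)%N) IH; lra.
have : cauchy (u @ \oo).
  apply: cauchy_exP => e e0.
  have [n rn] : exists n, r n < e / 4 by apply: r_lt; rewrite divr_gt0.
  exists (u n), n => // m /= /subnKC <-; rewrite -ball_normE /ball_/= distrC.
  by move: (ur n (m - n)%N) (r0 (n + (m - n))%N); lra.
move=> /cauchy_cvg/cvg_ex[/= l ul].
apply/cvg_ex; exists (quotient_map Y l); apply/cvgrPdist_lt => e e0.
have e20 : 0 < e / 2 by rewrite divr_gt0.
move/cvgrPdist_lt: ul => /(_ _ e20)[N _ uN].
have [M rM] := r_lt _ e20.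
pose n := maxn N M.
have rn : r n < e / 2.
  apply: le_lt_trans rM; apply: ler_wiXn2l; rewrite ?leq_maxr//.
  by rewrite invf_le1// ler1n.
apply: filterS (Fq n) => p; rewrite -ball_normE /ball_/= => pn.
rewrite -(subrKA (q n)) (le_lt_trans (ler_normD _ _))// (splitr e) ltrD//.
  rewrite -uq -raddfB (le_lt_trans (quotient_norm_le _ _))//.
  by apply: uN => /=; rewrite leq_maxl.
exact: lt_trans rn.
Qed.

HB.instance Definition _ (X : completeNormedModType R) (Y : closedSubspace X) :=
  Uniform_isComplete.Build (quotient_space Y) (@quotient_complete X Y).
End quotient.

Section operator_sum.
Context {R : realType} {V W1 W2 : normedModType R}.
Variables (T1 : {bounded V -> W1}) (T2 : {bounded V -> W2}).

Definition l1op : V -> l1sum W1 W2 := fun x => (T1 x, T2 x).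

Let l1op_linear : linear l1op.
Proof. by move=> a x y; rewrite /l1op !linearP. Qed.

Let l1op_bounded : bounded_fun_norm l1op.
Proof.
move=> r; have [M1 h1] := @bounded_fun_subproof _ _ _ T1 r.
have [M2 h2] := @bounded_fun_subproof _ _ _ T2 r.
by exists (M1 + M2) => x xr; rewrite l1sum_normE lerD ?h1 ?h2.
Qed.

HB.instance Definition _ :=
  GRing.isLinear.Build R V (l1sum W1 W2) *:%R l1op l1op_linear.
HB.instance Definition _ :=
  isBoundedFun.Build R V (l1sum W1 W2) l1op l1op_bounded.
End operator_sum.

Section daugavet.
Context {R : realType}.

(* Meaningful for bounded operators only: sup is a real number, and sup A = 0
   when A has no upper bound. *)
Definition opnorm (V W : normedModType R) (T : V -> W) : R :=
  sup [set `|T x| | x in [set x | `|x| <= 1]].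

(* The rank is exactly one: the zero operator is excluded. *)
Definition rank_one (V W : normedModType R) (T : V -> W) : Prop :=
  exists2 w, w != 0 & range T = range (fun a : R => a *: w).

Definition daugavet_property (X : completeNormedModType R) : Prop :=
  forall S : {bounded X -> X}, rank_one S ->
    opnorm (idfun \+ S) = 1 + opnorm S.

Definition daugavet_pair (X : completeNormedModType R)
    (Y : closedSubspace X) : Prop :=
  forall S : {bounded subspace_type Y -> X}, rank_one S ->
    opnorm (subspace_incl Y \+ S) = 1 + opnorm S.

Definition unit_sphere (X : normedModType R) : set X := [set x | `|x| = 1].

Definition strong_daugavet (X Z : completeNormedModType R)
    (T : {bounded X -> Z}) : Prop :=
  forall (x y : X) (e : R), unit_sphere x -> unit_sphere y -> 0 < e ->
  exists z, [/\ unit_sphere z, `|T (z - y)| < e & 2 - e < `|z + x|].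

Definition narrow (X Z : completeNormedModType R)
    (T : {bounded X -> Z}) : Prop :=
  forall f : {bounded X -> R^o}, strong_daugavet (l1op T f).

Definition rich (X : completeNormedModType R) (Y : closedSubspace X) : Prop :=
  narrow (quotient_map Y).
End daugavet.

(* Main.v *)
From HB Require Import structures.
Require Import Defs.
From mathcomp Require Import all_boot all_order all_algebra.
From mathcomp Require Import all_classical all_reals all_analysis.
From mathcomp Require Import ring lra.

Set Implicit Arguments.
Unset Strict Implicit.
Unset Printing Implicit Defensive.

Import Order.TTheory GRing.Theory Num.Theory.
Import numFieldNormedType.Exports.

Local Open Scope classical_set_scope.
Local Open Scope ring_scope.

(** Everything rests on one property of a rich subspace Y. Given unit vectors
    y in Y and w in X and a functional f on Y, there is a unit vector z of Y
    at which f takes almost the value f y, and such that z + w has norm almost 2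
    ([rich_daugavet_vector]). Indeed, extend f to a functional g on X by
    Hahn-Banach. Narrowness of the quotient map q means that q and g together
    form a strong Daugavet operator, which yields a unit vector z' of X with
    z' + w of norm almost 2, with g z' close to g y, and with q z' close to
    q y = 0. The last condition says that z' is close to Y; move it into Y and
    normalize it.

    A rank-one operator from Y to X has the form x |-> f x *: w with w of
    norm 1, and its norm is that of f. Choose y almost norming f, up to sign,
    and z as above. Since z + w is almost as long as the triangle inequality
    permits, so is z + t w for every t >= 0 ([norm_add_scale]); with t = f z,
    which is almost the norm of f, the norm of z + f z w is almost 1 + |f|.
    This is the Daugavet equation for the inclusion of Y into X
    ([rich_daugavet_eq]). An operator from Y to Y is a particular case, seen
    in X through the inclusion, which is isometric.

    The Hahn-Banach theorem is proved by applying Zorn's lemma to graphs of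
    dominated linear functionals on subspaces. *)

(** * The Hahn-Banach theorem *)

Section hahn_banach.
Context {R : realType} {V : lmodType R} (p : V -> R).
Hypothesis pD : forall u v, p (u + v) <= p u + p v.
Hypothesis pZ : forall a v, 0 < a -> p (a *: v) = a * p v.
Implicit Types (G : set (V * R^o)) (u v : V * R^o).

(** A partial linear functional below p, encoded as its graph so that unions of
    chains are plain unions of sets. Domination already forces such a graph to
    be single-valued, see [dominated_graph_fun]. *)
Definition dominated_graph G :=
  (forall a u v, G u -> G v -> G (a *: u + v)) /\
  (forall u, G u -> u.2 <= p u.1).

Lemma sublinear0 : p 0 = 0.
Proof. by have := @pZ 2 0 ltac:(lra); rewrite scaler0; lra. Qed.

Lemma dominated_graph0 G : dominated_graph G -> G !=set0 -> G 0.
Proof.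
by move=> [Gl _] [u Gu]; have := Gl (-1) _ _ Gu Gu; rewrite scaleN1r addNr.
Qed.

Lemma dominated_graphZ G a u : dominated_graph G -> G u -> G (a *: u).
Proof.
move=> Gd Gu; rewrite -[_ *: _]addr0; apply: Gd.1 => //.
by apply: dominated_graph0 Gd _; exists u.
Qed.

(** The difference of the two pairs is (0, r - s), so that domination and its
    opposite give r - s <= p 0 = 0 and s - r <= 0. *)
Lemma dominated_graph_fun G x (r s : R^o) : dominated_graph G ->
  G (x, r) -> G (x, s) -> r = s.
Proof.
move=> Gd.
have le_rs (r' s' : R^o) : G (x, r') -> G (x, s') -> r' <= s'.
  move=> Gr Gs; have := Gd.2 _ (Gd.1 (-1) _ _ Gs Gr).
  by rewrite /= !scaleN1r addNr sublinear0 addrC subr_le0.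
by move=> Gr Gs; apply/eqP; rewrite eq_le !le_rs.
Qed.

(** The value c that an extension may take at x. By subadditivity each
    v.2 - p (v.1 - x) lies below each p (u.1 + x) - u.2, and the supremum of
    the former separates the two families. The two inequalities are those of
    domination at u.1 + x and u.1 - x; homogeneity gives the other multiples
    of x. *)
Lemma dominated_slope G x : dominated_graph G -> G !=set0 ->
  exists c : R, forall u, G u ->
    u.2 + c <= p (u.1 + x) /\ u.2 - c <= p (u.1 - x).
Proof.
move=> Gd G0; pose E := [set u.2 - p (u.1 - x) | u in G].
have E0 : E !=set0 by case: G0 => u Gu; exists (u.2 - p (u.1 - x)), u.
have Eub u : G u -> ubound E (p (u.1 + x) - u.2).
  move=> Gu _ [v Gv <-].
  have := Gd.2 _ (Gd.1 1 _ _ Gu Gv); rewrite /= !scale1r.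
  have := pD (u.1 + x) (v.1 - x); rewrite addrACA subrr addr0.
  lra.
exists (sup E) => u Gu; split.
  by have := ge_sup E0 (Eub _ Gu); lra.
have : u.2 - p (u.1 - x) <= sup E.
  by apply: ub_le_sup; [exists (p (u.1 + x) - u.2); exact: Eub | exists u].
lra.
Qed.

Lemma dominated_graph_extend G x : dominated_graph G -> G !=set0 ->
  exists H, [/\ dominated_graph H, G `<=` H & exists c, H (x, c)].
Proof.
move=> Gd G0; have [c Gc] := dominated_slope x Gd G0.
exists [set u | exists2 v, G v & exists a, u = v + a *: (x, c : R^o)]; split.
- split=> [a _ _ [v Gv [b ->]] [w Gw [d ->]]|_ [v Gv [a ->]] /=].
    exists (a *: v + w); first exact: Gd.1.
    by exists (a * b + d); rewrite scalerDr scalerDl scalerA addrACA.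
  (* Dividing by b = |a| reduces to the coefficients 1 and -1 of x. *)
  have scaled b : 0 < b ->
      v.1 + a *: x = b *: ((b^-1 *: v).1 + (a / b) *: x) /\
      v.2 + a * c = b * ((b^-1 *: v).2 + (a / b) * c).
    move=> b0; have bN0 : b != 0 by rewrite gt_eqF.
    split; first by rewrite scalerDr !scalerA divff// scale1r mulrC divfK.
    by rewrite /= /GRing.scale /=; field.
  have [a0|a0|->] := ltgtP a 0; last first.
  + by rewrite !scale0r !addr0; exact: Gd.2.
  + have [-> ->] := scaled _ a0; rewrite pZ// ler_pM2l// divff ?gt_eqF//.
    rewrite scale1r mul1r.
    by apply: (Gc (a^-1 *: v) _).1; exact: dominated_graphZ.
  + have Na0 : 0 < - a by rewrite oppr_gt0.
    have [-> ->] := scaled _ Na0.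
    rewrite pZ// ler_pM2l// invrN mulrN divff ?lt_eqF//.
    rewrite scaleN1r mulN1r.
    by apply: (Gc (_ *: v) _).2; exact: dominated_graphZ.
- by move=> u Gu; exists u => //; exists 0; rewrite scale0r addr0.
- exists c, 0; first exact: dominated_graph0.
  by exists 1; rewrite scale1r add0r.
Qed.

Theorem hahn_banach G : dominated_graph G -> G !=set0 ->
  exists g : V -> R^o,
    [/\ linear g, forall x, g x <= p x & forall u, G u -> g u.1 = u.2].
Proof.
move=> Gd G0.
(* The implication lets the empty set, the union of the empty chain, satisfy P
   while every other member of P still extends G. *)
pose P H := dominated_graph H /\ (H !=set0 -> G `<=` H).
have [F FP Ftot|M [[Md GM] Mmax]] := @Zorn_bigcup _ P.
  split; last first.
    move=> [u [H FH Hu]] v Gv; exists H => //.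
    by apply: (FP _ FH).2 Gv; exists u.
  split=> [a u v [H FH Hu] [K FK Kv]|u [H FH]]; last exact: (FP _ FH).1.2.
  have [HK|KH] := Ftot _ _ FH FK.
    by exists K => //; apply: (FP _ FK).1.1 => //; exact: HK.
  by exists H => //; apply: (FP _ FH).1.1 => //; exact: KH.
have M0 : M !=set0.
  have [M0|/set0P//] := eqVneq M set0; exfalso.
  apply: (Mmax G); last by split=> // _ u.
  by rewrite M0; split=> // GM0; case: G0 => u /GM0.
have /choice[g gM] x : exists c, M (x, c).
  have [H [Hd MH [c Hc]]] := dominated_graph_extend x Md M0; exists c.
  apply: contrapT => Mc; apply: (Mmax H).
    by split=> // /(_ _ Hc).
  by split=> // _; exact: subset_trans (GM M0) MH.
exists g; split=> [a x y|x|[x r] /(GM M0)/= Mr].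
- apply: (dominated_graph_fun Md (gM _)).
  exact: (Md.1 a _ _ (gM x) (gM y)).
- exact: Md.2 (gM x).
- exact: (dominated_graph_fun Md (gM x)).
Qed.
End hahn_banach.

(** * Operator norms *)

Section operator_norm.
Context {R : realType} {V W : normedModType R}.

Lemma ge_opnorm (T : V -> W) c :
  (forall x, `|x| <= 1 -> `|T x| <= c) -> opnorm T <= c.
Proof.
move=> Tc; apply: ge_sup; first by exists `|T 0|, 0; rewrite //= normr0.
by move=> _ [x x1 <-]; exact: Tc.
Qed.

Lemma le_opnorm (T : V -> W) x :
  bounded_fun_norm T -> `|x| <= 1 -> `|T x| <= opnorm T.
Proof.
move=> /(_ 1)[M TM] x1; apply: ub_le_sup; last by exists x.
by exists M => _ [y y1 <-]; exact: TM.
Qed.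

Lemma opnorm_bound (T : {linear V -> W}) x :
  bounded_fun_norm T -> `|T x| <= opnorm T * `|x|.
Proof.
move=> Tb; have [->|x0] := eqVneq x 0; first by rewrite linear0 !normr0 mulr0.
have nx : 0 < `|x| by rewrite normr_gt0.
rewrite -ler_pdivrMr// mulrC -[`|x|^-1]ger0_norm ?invr_ge0//.
rewrite -normrZ -linearZ le_opnorm// normrZ ger0_norm ?invr_ge0//.
by rewrite mulVf// gt_eqF.
Qed.
End operator_norm.

(** * Rank-one operators on rich subspaces *)

Section rich.
Context {R : realType}.

Lemma functional_extension (X : normedModType R) (Y : closedSubspace X)
    (f : {linear subspace_type Y -> R^o}) : bounded_fun_norm f ->
  exists g : {bounded X -> R^o}, forall y, g (val y) = f y.
Proof.
move=> fb; pose p (x : X) := opnorm f * `|x|.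
have f0 : 0 <= opnorm f.
  by apply: le_trans (le_opnorm fb (x := 0) _); rewrite ?normr0.
pose G : set (X * R^o) := range (fun y : subspace_type Y => (val y, f y)).
have [|a x a0|||g [gl gp gf]] := @hahn_banach _ _ p _ _ G.
- by move=> x y; rewrite /p -mulrDr ler_wpM2l// ler_normD.
- by rewrite /p normrZ gtr0_norm// mulrCA.
- split=> [a _ _ [y _ <-] [z _ <-]|_ [y _ <-]/=].
    by exists (a *: y + z) => //; rewrite !linearP.
  exact: le_trans (ler_norm _) (opnorm_bound _ fb).
- by exists (val (0 : subspace_type Y), f 0); exists 0.
pose gL := GRing.isLinear.Build _ _ _ _ g gl.
pose lg : {linear X -> R^o} := HB.pack g gL.
have gb : bounded_fun_norm g.
  move=> r; exists (opnorm f * r) => x xr.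
  apply: (@le_trans _ _ (p x)); last by rewrite ler_wpM2l.
  rewrite ler_norml gp andbT lerNl.
  by rewrite -[g x]/(lg x) -linearN (le_trans (gp _))// /p normrN.
pose gB := isBoundedFun.Build _ _ _ g gb.
pose bg : {bounded X -> R^o} := HB.pack g gL gB.
by exists bg => y; apply: (gf (val y, f y)); exists y.
Qed.

(** The vector z' supplied by narrowness is within d of some u in Y, and
    normalizing u moves it by less than d again, so z is within 2 d of z'.
    Hence f z differs from f y by less than 2 M d + d, with M the norm of an
    extension of f, and z + w is longer than 2 - 3 d. *)
Lemma rich_daugavet_vector (X : completeNormedModType R) (Y : closedSubspace X)
    (f : {linear subspace_type Y -> R^o}) (y : subspace_type Y) (w : X) (e : R) :
  rich Y -> bounded_fun_norm f -> `|y| = 1 -> `|w| = 1 -> 0 < e ->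
  exists z : subspace_type Y,
    [/\ `|z| = 1, `|f z - f y| < e & 2 - e < `|val z + w|].
Proof.
move=> Yrich fb y1 w1 e0.
have [g gf] := functional_extension fb.
have gb : bounded_fun_norm g by exact: bounded_fun_subproof.
pose M := opnorm g.
have M0 : 0 <= M.
  by apply: le_trans (le_opnorm gb (x := 0) _); rewrite ?normr0.
(* The summand e makes d < 1, so that u below is nonzero. *)
pose k := 2 * M + 3 + e.
have k0 : 0 < k by rewrite /k; lra.
pose d := e / k.
have d0 : 0 < d by rewrite divr_gt0.
have dk : d * (2 * M + 3) + d * e = e by rewrite -mulrDr /d divfK ?gt_eqF.
have dM0 : 0 <= d * M by rewrite mulr_ge0// ltW.
have de0 : 0 < d * e by rewrite mulr_gt0.
have d1 : d < 1 by rewrite ltr_pdivrMr// /k; lra.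
have [z' [z'1]] := Yrich g w (val y) d w1 y1 d0.
rewrite l1sum_normE /= => qgd z'w.
have qd : quotient_norm (quotient_map Y (z' - val y)) < d.
  by apply: le_lt_trans qgd; rewrite lerDl.
have gd : `|g (z' - val y)| < d by apply: le_lt_trans qgd; rewrite lerDr.
have [x xq xd] := quotient_norm_lt qd.
pose u := z' - x.
have uY : u \in Y.
  have /quotient_map_eq uyY := esym xq.
  have -> : u = (z' - val y - x) + val y by rewrite /u addrAC subrK.
  by apply: rpredD uyY (valP y).
have uz' : u - z' = - x by rewrite /u addrAC subrr add0r.
have nu : `| `|u| - 1 | < d.
  by rewrite -z'1 (le_lt_trans (ler_dist_dist _ _))// uz' normrN.
have u0 : 0 < `|u| by move: nu; rewrite ltr_norml => /andP[]; lra.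
have zY : `|u|^-1 *: u \in Y by exact: rpredZ.
pose z : subspace_type Y := exist (fun x => x \in Y) _ zY.
have z1 : `|z| = 1.
  by rewrite subspace_normE /= normrZ gtr0_norm ?invr_gt0// mulVf ?gt_eqF.
have zu : `|val z - u| < d.
  have -> : val z - u = (1 - `|u|) *: (val z).
    by rewrite scalerBl scale1r /= scalerA divff ?gt_eqF// scale1r.
  by rewrite normrZ -subspace_normE z1 mulr1 distrC.
have zz' : `|val z - z'| < 2 * d.
  rewrite -(subrKA u) (le_lt_trans (ler_normD _ _))// uz' normrN.
  by move: zu xd; lra.
exists z; split => //.
- rewrite -!gf -linearB -(subrKA z') linearD.
  rewrite (le_lt_trans (ler_normD _ _))//.
  have := opnorm_bound (val z - z') gb; rewrite -/M.
  have : M * `|val z - z'| <= M * (2 * d) by rewrite ler_wpM2l// ltW.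
  by move: gd dk; lra.
- have : `|z' + w| <= `|z' - val z| + `|val z + w|.
    by rewrite -[z' + w](subrKA (val z)) ler_normD.
  rewrite distrC.
  by move: zz' z'w dk; lra.
Qed.

(** Compare z + t w with z + w when t <= 1 and with t (z + w) when t >= 1: the
    difference is a multiple of one unit vector, of norm |1 - t|. *)
Lemma norm_add_scale (X : normedModType R) (z w : X) (e t : R) :
  `|z| = 1 -> `|w| = 1 -> 2 - e <= `|z + w| -> 0 <= e -> 0 <= t ->
  (1 + t) * (1 - e) <= `|z + t *: w|.
Proof.
move=> z1 w1 zw e0 t0; have [t1|/ltW t1] := leP t 1.
  have : `|z + w| <= `|z + t *: w| + (1 - t).
    have -> : z + w = (z + t *: w) + (1 - t) *: w.
      by rewrite scalerBl scale1r addrACA subrr addr0.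
    by rewrite (le_trans (ler_normD _ _))// normrZ w1 mulr1 ger0_norm; lra.
  have : 0 <= e * t by rewrite mulr_ge0.
  lra.
have : t * `|z + w| <= `|z + t *: w| + (t - 1).
  rewrite -{1}(ger0_norm t0) -normrZ.
  have -> : t *: (z + w) = (z + t *: w) + (t - 1) *: z.
    by rewrite scalerBl scale1r scalerDr [RHS]addrC subrKA.
  by rewrite (le_trans (ler_normD _ _))// normrZ z1 mulr1 ger0_norm; lra.
have : t * (2 - e) <= t * `|z + w| by rewrite ler_wpM2l.
lra.
Qed.

(** Normalizing the vector w makes the norms of S x and f x equal. *)
Lemma rank_one_functional (V W : normedModType R) (S : {linear V -> W}) :
  rank_one S -> exists (w : W) (f : {linear V -> R^o}),
    [/\ `|w| = 1, forall x, S x = f x *: w & exists x, f x != 0].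
Proof.
move=> [w w0 Sw]; pose w' := `|w|^-1 *: w.
have nw0 : `|w| != 0 by rewrite normr_eq0.
have w'1 : `|w'| = 1 by rewrite normrZ ger0_norm ?invr_ge0// mulVf.
have w'0 : w' != 0 by rewrite -normr_eq0 w'1 oner_eq0.
have /choice[f fS] x : exists a : R^o, S x = a *: w'.
  have : range S (S x) by exists x.
  rewrite Sw => -[a _ <-]; exists (a * `|w|).
  by rewrite /w' scalerA mulfK.
have fl : linear f.
  move=> a x y; apply/eqP; rewrite -subr_eq0.
  suff : (f (a *: x + y) - (a * f x + f y)) *: w' == 0.
    by rewrite scaler_eq0 (negPf w'0) orbF.
  by rewrite scalerBl scalerDl -scalerA -!fS linearP subrr.
pose fL := GRing.isLinear.Build _ _ _ _ f fl.
exists w', (HB.pack f fL : {linear V -> R^o}); split => //=.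
have : range S w by rewrite Sw; exists 1 => //; rewrite scale1r.
move=> [x _ Sx]; exists x; apply: contra_neq w0 => fx0.
by rewrite -Sx fS fx0 scale0r.
Qed.

Lemma rich_daugavet_eq (X : completeNormedModType R) (Y : closedSubspace X)
    (S : {linear subspace_type Y -> X}) :
  rich Y -> bounded_fun_norm S -> rank_one S ->
  opnorm (subspace_incl Y \+ S) = 1 + opnorm S.
Proof.
move=> Yrich Sb /rank_one_functional[w [f [w1 Sf [x0 fx0]]]].
have le_sum y : `|y| <= 1 -> `|(subspace_incl Y \+ S) y| <= 1 + opnorm S.
  move=> y1; rewrite (le_trans (ler_normD _ _))// lerD//.
  exact: le_opnorm.
apply/eqP; rewrite eq_le ge_opnorm//=.
have nS y : `|S y| = `|f y| by rewrite Sf normrZ w1 mulr1.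
have fb : bounded_fun_norm f.
  by move=> r; have [M SM] := Sb r; exists M => y /SM; rewrite nS.
set s := opnorm S.
have s0 : 0 < s.
  have := opnorm_bound x0 Sb; rewrite nS -/s => sx0.
  have : 0 < s * `|x0| by apply: lt_le_trans sx0; rewrite normr_gt0.
  by rewrite !ltNge; apply: contraNN => s0; rewrite mulr_le0_ge0.
apply/ler_addgt0Pr => r r0.
(* With f z between s - 2 e and s, (1 + f z) (1 - e) is at least
   1 + s - e (3 + s); the first bound on e keeps f z nonnegative. *)
pose e := Num.min (s / 2) (r / (3 + s)).
have e0 : 0 < e by rewrite lt_min !divr_gt0//; lra.
have es : 2 * e <= s.
  have : e <= s / 2 by rewrite ge_min lexx.
  lra.
have er : e * (3 + s) <= r.
  by rewrite -ler_pdivlMr; [rewrite ge_min lexx orbT | lra].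
have [y y1 fy] : exists2 y, `|y| = 1 & s - e < f y.
  have Sn0 : [set `|S y| | y in [set y | `|y| <= 1]] !=set0.
    by exists `|S 0|, 0; rewrite //= normr0.
  have [|_ [y /= y1 <-]] := @sup_gt _ _ (s - e) Sn0.
    by rewrite -/(opnorm S) -/s; lra.
  rewrite nS => fy.
  have nf : 0 < `|f y| by apply: lt_trans fy; lra.
  have y0 : 0 < `|y|.
    rewrite normr_gt0; apply: contraTneq nf => ->.
    by rewrite linear0 normr0 ltxx.
  (* The sign makes f positive and the norm of the vector becomes 1. *)
  exists ((Num.sg (f y) / `|y|) *: y).
    rewrite normrZ normrM normr_sg -normr_eq0 gt_eqF//= mul1r.
    by rewrite normfV normr_id mulVf// gt_eqF.
  rewrite linearZ /= /GRing.scale/= mulrAC -normrEsg.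
  apply: lt_le_trans fy _; rewrite ler_pdivlMr//.
  by rewrite ler_piMr.
have [z [z1 fz zw]] := rich_daugavet_vector Yrich fb y1 w1 e0.
have fz' : s - 2 * e < f z by move: fz; rewrite ltr_norml => /andP[]; lra.
have sumb : bounded_fun_norm (subspace_incl Y \+ S).
  move=> c; have [M SM] := Sb c; exists (c + M) => v vc.
  by rewrite (le_trans (ler_normD _ _))// lerD// SM.
have := le_opnorm sumb (x := z); rewrite z1 lexx => /(_ isT).
rewrite /= Sf => zle.
have := @norm_add_scale _ (val z) w e (f z) z1 w1 (ltW zw) (ltW e0).
move=> /(_ ltac:(lra)) /le_trans /(_ zle).
have fzs : f z <= s.
  by rewrite (le_trans (ler_norm _))// -nS le_opnorm// z1.
have : e * f z <= e * s by rewrite ler_wpM2l// ltW.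
lra.
Qed.
End rich.

(** * Rich subspaces inherit the Daugavet property *)

Theorem theorem5p2 (R : realType) (X : completeNormedModType R)
    (Y : closedSubspace X) (XD : daugavet_property X) (Yrich : rich Y) :
  daugavet_property (subspace_type Y) /\ daugavet_pair Y.
Proof.
split=> S S1; last exact: rich_daugavet_eq Yrich bounded_fun_subproof S1.
have SXb : bounded_fun_norm (subspace_incl Y \o S).
  exact: (@bounded_fun_subproof _ _ _ S).
have SX1 : rank_one (subspace_incl Y \o S).
  case: S1 => w w0 Sw; exists (val w).
    by apply: contra_neq w0 => w0; apply/val_inj; rewrite w0 raddf0.
  have -> : (fun a : R => a *: val w) =
      subspace_incl Y \o (fun a : R => a *: w).
    by apply/funext => a /=; rewrite linearZ.
  by rewrite -(image_comp S) Sw image_comp.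
(* Norms in Y are norms in X, so this equation is the one for S itself. *)
exact: rich_daugavet_eq Yrich SXb SX1.
Qed.
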